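(* Let $\mathcal V$ be a commutative semigroup variety. If $\mathcal V$ is a lower-modular element of the lattice $\mathbf{Com}$ of all commutative semigroup varieties, then $\mathcal V$ is a modular element of $\mathbf{Com}$.
   Context: A semigroup variety is a class of semigroups defined by a set of semigroup identities. $\mathbf{Com}$ is the lattice (under inclusion) of all varieties consisting of commutative semigroups; meet is intersection and join is the least variety containing both. An element $x$ of a lattice $L$ is modular if for all $y,z\in L$ with $y\le z$ one has $(x\vee y)\wedge z=(x\wedge z)\vee y$; it is lower-modular if for all $y,z\in L$ with $x\le y$ one has $x\vee(y\wedge z)=y\wedge(x\vee z)$. *)

(* Defs.v *)
From HB Require Import structures.
#[warnings="-notation-overridden"]
From mathcomp Require Import all_boot all_order.
From mathcomp Require Import boolp classical_sets.

Set Implicit Arguments.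
Unset Strict Implicit.
Unset Printing Implicit Defensive.

Import Order.TTheory.

Local Open Scope classical_set_scope.

(* The library's [semigroupType] is not used: it carries a [choiceType], so the
   type of classes of [semigroupType]s is too large to be itself a
   [choiceType], hence to be a [latticeType]. *)
Record semigroup := MkSemigroup {
  sg_sort :> Type;
  sg_mul : sg_sort -> sg_sort -> sg_sort;
  sg_mulA : associative sg_mul;
  sg_inhabited : inhabited sg_sort
}.

(* A nonempty word over a countable alphabet: its first letter and the
   sequence of the remaining ones. *)
Definition word := (nat * seq nat)%type.

Definition eval (S : semigroup) (phi : nat -> S) (w : word) : S :=
  foldl (fun a i => sg_mul a (phi i)) (phi w.1) w.2.

(* The pair (u, v) stands for the identity u = v. *)
Definition identity := (word * word)%type.

Definition satisfies (S : semigroup) (p : identity) : Prop :=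
  forall phi : nat -> S, eval phi p.1 = eval phi p.2.

Definition models (Sigma : set identity) : set semigroup :=
  [set S | forall p, Sigma p -> satisfies S p].

Definition is_variety (K : set semigroup) : Prop :=
  exists Sigma : set identity, K = models Sigma.

Definition commutative_class (K : set semigroup) : Prop :=
  forall S, K S -> commutative (@sg_mul S).

Record Com := MkCom {
  com_class :> set semigroup;
  com_variety : is_variety com_class;
  com_commutative : commutative_class com_class
}.

Definition variety_join (K L : set semigroup) : set semigroup :=
  [set S | forall W, is_variety W -> K `<=` W -> L `<=` W -> W S].

Section ComLattice.

Definition identities (K : set semigroup) : set identity :=
  [set p | forall S, K S -> satisfies S p].

Lemma variety_joinE K L : variety_join K L = models (identities (K `|` L)).
Proof.
apply/seteqP; split => S /=.
  apply; first by exists (identities (K `|` L)).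
    by move=> T KT p; apply; left.
  by move=> T LT p; apply; right.
move=> HS W [Sigma ->] KW LW p Sp; apply: HS => T [/KW|/LW]; exact.
Qed.

Lemma sub_variety_joinl K L : K `<=` variety_join K L.
Proof. by move=> S KS W _ /(_ _ KS). Qed.

Lemma sub_variety_joinr K L : L `<=` variety_join K L.
Proof. by move=> S LS W _ _ /(_ _ LS). Qed.

Lemma variety_join_least K L W :
  is_variety W -> K `<=` W -> L `<=` W -> variety_join K L `<=` W.
Proof. by move=> vW KW LW S; apply. Qed.

Lemma is_variety_join K L : is_variety (variety_join K L).
Proof. by exists (identities (K `|` L)); exact: variety_joinE. Qed.

Lemma is_varietyI K L : is_variety K -> is_variety L -> is_variety (K `&` L).
Proof.
move=> [A ->] [B ->]; exists (A `|` B); apply/seteqP; split => S /=.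
  by move=> [SA SB] p [/SA|/SB].
by move=> SAB; split=> p Hp; apply: SAB; [left|right].
Qed.

Definition commutativity : identity := ((0, [:: 1]), (1, [:: 0])).

Lemma satisfies_commutativity S :
  satisfies S commutativity <-> commutative (@sg_mul S).
Proof.
split=> [H x y|H phi]; last exact: H.
exact: (H (fun i => if i is 0 then x else y)).
Qed.

Lemma commutative_join K L : commutative_class K -> commutative_class L ->
  commutative_class (variety_join K L).
Proof.
move=> cK cL S; rewrite variety_joinE => SKL.
apply/satisfies_commutativity; apply: SKL => T KLT.
by apply/satisfies_commutativity; case: KLT; [exact: cK|exact: cL].
Qed.

Lemma commutativeI K L : commutative_class K -> commutative_class (K `&` L).
Proof. by move=> cK S [/cK]. Qed.

Definition com_meet (V W : Com) : Com :=
  MkCom (is_varietyI (com_variety V) (com_variety W))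
        (commutativeI (L := W) (@com_commutative V)).

Definition com_join (V W : Com) : Com :=
  MkCom (is_variety_join V W)
        (commutative_join (@com_commutative V) (@com_commutative W)).

Lemma com_inj (V W : Com) : V = W :> set semigroup -> V = W.
Proof.
case: V W => [K vK cK] [L vL cL] /= KL; subst L.
by congr MkCom; exact: Prop_irrelevance.
Qed.

Definition com_le (V W : Com) : bool := `[< V `<=` W >].

Lemma com_le_refl : reflexive com_le.
Proof. by move=> V; apply/asboolP. Qed.

Lemma com_le_anti : antisymmetric com_le.
Proof.
move=> V W /andP[/asboolP VW /asboolP WV].
by apply: com_inj; apply/seteqP; split.
Qed.

Lemma com_le_trans : transitive com_le.
Proof.
by move=> W V X /asboolP VW /asboolP WX; apply/asboolP => S /VW /WX.
Qed.

Fact com_display : Order.disp_t. Proof. exact. Qed.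

HB.instance Definition _ := gen_eqMixin Com.
HB.instance Definition _ := gen_choiceMixin Com.
HB.instance Definition _ := Order.Le_isPOrder.Build com_display Com
  com_le_refl com_le_anti com_le_trans.

Lemma com_leE (V W : Com) : (V <= W)%O = `[< V `<=` W >].
Proof. by []. Qed.

Lemma com_meetP (V W X : Com) :
  (V <= com_meet W X)%O = (V <= W)%O && (V <= X)%O.
Proof.
rewrite !com_leE -asbool_and; apply: asbool_equiv_eq.
split => [H|[VW VX] S VS]; last by split; [exact: VW|exact: VX].
by split=> S /H [].
Qed.

Lemma com_joinP (V W X : Com) :
  (com_join V W <= X)%O = (V <= X)%O && (W <= X)%O.
Proof.
rewrite !com_leE -asbool_and; apply: asbool_equiv_eq; split => [H|[VX WX]].
  by split; apply: subset_trans H; [exact: sub_variety_joinl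
                                   |exact: sub_variety_joinr].
exact: variety_join_least (com_variety X) VX WX.
Qed.

HB.instance Definition _ :=
  Order.POrder_MeetJoin_isLattice.Build com_display Com
    com_meetP com_joinP.

Lemma com_meetE (V W : Com) : (V `&` W)%O = V `&` W :> set semigroup.
Proof. by []. Qed.

Lemma com_joinE (V W : Com) : (V `|` W)%O = variety_join V W :> set semigroup.
Proof. by []. Qed.

End ComLattice.

Definition modular_element d (L : latticeType d) (x : L) : Prop :=
  forall y z : L, (y <= z)%O -> ((x `|` y) `&` z = (x `&` z) `|` y)%O.

Definition lower_modular_element d (L : latticeType d) (x : L) : Prop :=
  forall y z : L, (x <= y)%O -> (x `|` (y `&` z) = y `&` (x `|` z))%O.

(* Main.v *)
Require Import Defs.
From mathcomp Require Import all_boot all_order.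
From mathcomp Require Import boolp classical_sets.
From mathcomp Require Import zify.

(* Commutative varieties correspond, with inclusion reversed, to the fully
   invariant congruences of the free commutative semigroup, so a lower-modular
   variety is a congruence A with A /\ (B \/ C) <= B \/ (A /\ C) for all B <= A
   and all C.  Suppose that A is not the equality.  If C relates u to c and d
   to v, if A relates u to v and c to d, and if c and d lie in a fully
   invariant ideal K avoiding u, then the inequality for B = A /\ (Rees
   congruence of K) provides w <> u related to u by both A and C.  Well-chosen
   C and K then show successively that A contains some x^N = x^(N+1), that
   A-related words of equal content differ only in letters they absorb (u
   absorbs x when u A ux), and, if A preserves contents, that a word absorbing
   one of its letters absorbs them all.  Hence A is the Rees congruence of an
   ideal, or the intersection of one with equality of contents, and both are
   modular. *)

Set Implicit Arguments.
Unset Strict Implicit.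
Unset Printing Implicit Defensive.

Import Order.TTheory.

Local Open Scope classical_set_scope.

(** * Commutative words *)

Definition subst (f : nat -> seq nat) (u : seq nat) : seq nat :=
  flatten (map f u).

Definition pow (k : nat) (t : seq nat) : seq nat := flatten (nseq k t).

Definition nonerasing (f : nat -> seq nat) : Prop := forall i, f i <> [::].

Lemma perm_eqP (u v : seq nat) :
  (forall x, count_mem x u = count_mem x v) <-> perm_eq u v.
Proof.
split=> [uv|/permP uv x]; last exact: uv.
by apply/allP => x _ /=; rewrite uv.
Qed.

Lemma nperm_eqP (u v : seq nat) :
  ~ perm_eq u v -> exists x, count_mem x u <> count_mem x v.
Proof. by move=> nuv; apply/existsNP => uv; apply/nuv/perm_eqP. Qed.

Lemma neq_contentP (u v : seq nat) :
  ~ (u =i v) -> exists x, (x \in u) <> (x \in v).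
Proof. by move=> nuv; apply/existsNP. Qed.

Lemma subst_cat f u v : subst f (u ++ v) = subst f u ++ subst f v.
Proof. by rewrite /subst map_cat flatten_cat. Qed.

Lemma subst_comp f g u : subst f (subst g u) = subst (subst f \o g) u.
Proof. by elim: u => //= x u IHu; rewrite [LHS]subst_cat IHu. Qed.

Lemma subst_id f u : {in u, forall x, f x = [:: x]} -> subst f u = u.
Proof.
elim: u => //= x u IHu fu; rewrite /subst /= fu ?mem_head//=.
by congr cons; apply: IHu => y yu; rewrite fu// inE yu orbT.
Qed.

Lemma subst_nseq f k x : subst f (nseq k x) = pow k (f x).
Proof. by rewrite /subst map_nseq. Qed.

Lemma subst_const f x u :
  {in u, forall z, f z = [:: x]} -> subst f u = nseq (size u) x.
Proof.
elim: u => //= z u IHu fu; rewrite /subst /= fu ?mem_head//=.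
by congr cons; apply: IHu => y yu; rewrite fu// inE yu orbT.
Qed.

Lemma pow_nseq j k (x : nat) : pow j (nseq k x) = nseq (j * k) x.
Proof. by elim: j => //= j IHj; rewrite mulSn nseqD -IHj. Qed.

Lemma pow_cons j x t : perm_eq (pow j (x :: t)) (nseq j x ++ pow j t).
Proof.
elim: j => //= j IHj; rewrite /pow /= perm_cons -/(pow _ _).
by rewrite perm_sym perm_catCA perm_cat2l perm_sym.
Qed.

Lemma count_pow a k t : count a (pow k t) = k * count a t.
Proof. by rewrite count_flatten map_nseq sumn_nseq mulnC. Qed.

Lemma mem_pow x k t : 0 < k -> (x \in pow k t) = (x \in t).
Proof.
by move=> k_gt0; rewrite -!has_pred1 !has_count count_pow muln_gt0 k_gt0.
Qed.

Lemma mem_substP f u x :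
  reflect (exists2 z, z \in u & x \in f z) (x \in subst f u).
Proof. exact: flatten_mapP. Qed.

Lemma subst_content f u v : u =i v -> subst f u =i subst f v.
Proof.
by move=> uv x; apply/mem_substP/mem_substP => -[z zu xz]; exists z;
   rewrite // ?uv // -uv.
Qed.

Lemma perm_subst f u v : perm_eq u v -> perm_eq (subst f u) (subst f v).
Proof. by move=> uv; apply/perm_flatten/perm_map. Qed.

Lemma subst_neq0 f u : nonerasing f -> u <> [::] -> subst f u <> [::].
Proof. by case: u => // x u nf _; rewrite /subst /=; case: (f x) (nf x). Qed.

Lemma count_subst f u r x : uniq r -> {subset u <= r} ->
  count_mem x (subst f u) = \sum_(z <- r) count_mem z u * count_mem x (f z).
Proof.
move=> r_uniq; elim: u => [|y u IHu] ur.
  by rewrite big1// => z _; rewrite mul0n.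
rewrite /subst /= count_cat IHu; last by move=> z zu; rewrite ur// inE zu orbT.
under [RHS]eq_bigr do rewrite /= mulnDl.
rewrite big_split /=; congr addn.
rewrite (bigD1_seq y) ?ur ?mem_head//= eqxx mul1n big1 ?addn0// => z.
by rewrite eq_sym => /negPf ->.
Qed.

(** The exponent of [x] in the image is a linear form in the exponents of the letters, with
    coefficient zero at each [z] whose image avoids [x]. *)
Lemma count_subst_modn M f u v x :
  (forall z, x \in f z -> count_mem z u = count_mem z v %[mod M]) ->
  count_mem x (subst f u) = count_mem x (subst f v) %[mod M].
Proof.
move=> uv; have r_uniq := undup_uniq (u ++ v).
rewrite !(@count_subst _ _ (undup (u ++ v))) //; last 2 first.
- by move=> z zu; rewrite mem_undup mem_cat zu ?orbT.
- by move=> z zu; rewrite mem_undup mem_cat zu ?orbT.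
rewrite -modn_summ -[RHS]modn_summ; congr modn; apply: eq_bigr => z _.
have [xz|xz] := boolP (x \in f z); last by rewrite (count_memPn xz) !muln0.
by rewrite -modnMml uv// modnMml.
Qed.

Lemma count_subst_eq f u v x :
  (forall z, x \in f z -> count_mem z u = count_mem z v) ->
  count_mem x (subst f u) = count_mem x (subst f v).
Proof.
(* Congruence modulo [0] is equality. *)
move=> uv; rewrite -[LHS]modn0 -[RHS]modn0.
by apply: count_subst_modn => z /uv ->.
Qed.

Lemma leq_count_subst f u x z :
  x \in f z -> count_mem z u <= count_mem x (subst f u).
Proof.
move=> xz; elim: u => //= y u IHu; rewrite /subst /= count_cat.
apply: leq_add => //; have [->|//] := eqVneq y z.
by rewrite -has_count has_pred1.
Qed.

Lemma leq_size_subst f u : nonerasing f -> size u <= size (subst f u).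
Proof.
move=> nf; elim: u => //= x u IHu; rewrite /subst /= size_cat.
case: (f x) (nf x) => //= _ s _.
by rewrite addSn ltnS (leq_trans IHu)// leq_addl.
Qed.

Lemma eq_size_subst f u : nonerasing f ->
  (size (subst f u) == size u) = all (fun z => size (f z) == 1) u.
Proof.
move=> nf; elim: u => //= x u IHu; rewrite -IHu /subst /= size_cat.
have := leq_size_subst u nf; rewrite /subst.
by case: (f x) (nf x) => //= _ s _; lia.
Qed.

Lemma perm_count_split (x : nat) (u : seq nat) :
  perm_eq u (nseq (count_mem x u) x ++ filter (predC1 x) u).
Proof.
have <- : filter (pred1 x) u = nseq (count_mem x u) x.
  by rewrite -size_filter; apply/all_pred1P; exact: filter_all.
by rewrite perm_sym perm_filterC.
Qed.

Lemma ex_max_count (s : seq nat) : s <> [::] ->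
  exists2 y, y \in s & forall z, count_mem z s <= count_mem y s.
Proof.
case: s => // a s _; set u := a :: s.
have exP : exists n, has (fun z => count_mem z u == n) u.
  by exists (count_mem a u); apply/hasP; exists a; rewrite ?mem_head.
have ubP n : has (fun z => count_mem z u == n) u -> n <= size u.
  by move=> /hasP[z _ /eqP <-]; exact: count_size.
case: (ex_maxnP exP ubP) => n /hasP[y yu /eqP <-] ymax.
exists y => // z; have [zu|/count_memPn -> //] := boolP (z \in u).
by apply: ymax; apply/hasP; exists z.
Qed.

(** * Fully invariant congruences *)

(* A fully invariant congruence on the free commutative monoid whose class of
   the empty word is trivial, i.e. a fully invariant congruence on the free
   commutative semigroup. *)
Record theory (R : seq nat -> seq nat -> Prop) : Prop := Theory {
  theory_perm : forall u v, perm_eq u v -> R u v;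
  theory_sym : forall u v, R u v -> R v u;
  theory_trans : forall v u w, R u v -> R v w -> R u w;
  theory_cat : forall u v w, R u v -> R (u ++ w) (v ++ w);
  theory_subst : forall f u v,
    nonerasing f -> R u v -> R (subst f u) (subst f v);
  theory_nil : forall v, R [::] v -> v = [::]
}.

Definition subtheory (R S : seq nat -> seq nat -> Prop) : Prop :=
  forall u v, R u v -> S u v.

Definition tmeet (R S : seq nat -> seq nat -> Prop) u v : Prop :=
  R u v /\ S u v.

Definition equivalence (E : seq nat -> seq nat -> Prop) : Prop :=
  [/\ forall u, E u u, forall u v, E u v -> E v u
    & forall v u w, E u v -> E v w -> E u w].

(** Impredicative form of a finite chain of alternating steps: a consequence is drawn from it by
    choosing one equivalence [E]. *)
Definition tjoin (R S : seq nat -> seq nat -> Prop) u v : Prop :=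
  forall E, equivalence E -> subtheory R E -> subtheory S E -> E u v.

Definition homotypical (R : seq nat -> seq nat -> Prop) : Prop :=
  forall u v, R u v -> u =i v.

Lemma theory_equivalence R : theory R -> equivalence R.
Proof.
move=> tR; split; [|exact: theory_sym|exact: theory_trans].
by move=> u; exact: theory_perm.
Qed.

Lemma theory_nilE R u v : theory R -> R u v -> (u == [::]) = (v == [::]).
Proof.
move=> tR; case: u v => [|x u] [|y v] //.
  by move=> /(theory_nil tR).
by move=> /(theory_sym tR) /(theory_nil tR).
Qed.

Lemma theory_catl R w u v : theory R -> R u v -> R (w ++ u) (w ++ v).
Proof.
move=> tR uv; have wC s : R (w ++ s) (s ++ w).
  by apply: theory_perm => //; rewrite perm_catC.
apply: (theory_trans tR (wC u)).
by apply: (theory_trans tR _ (theory_sym tR (wC v))); exact: theory_cat.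
Qed.

Lemma theory_cons R x u v : theory R -> R u v -> R (x :: u) (x :: v).
Proof. by move=> tR; exact: (@theory_catl R [:: x]). Qed.

Lemma theory_tmeet R S : theory R -> theory S -> theory (tmeet R S).
Proof.
move=> tR tS.
split=> [u v uv|u v []|v u w [Ruv Suv] [Rvw Svw]|u v w []|f u v nf []|v []].
- by split; exact: theory_perm.
- by split; exact: theory_sym.
- by split; [exact: theory_trans Rvw|exact: theory_trans Svw].
- by split; exact: theory_cat.
- by split; exact: theory_subst.
- by move=> /(theory_nil tR).
Qed.

Lemma tjoinl R S : subtheory R (tjoin R S).
Proof. by move=> u v Ruv E _ RE _; exact: RE. Qed.

Lemma tjoinr R S : subtheory S (tjoin R S).
Proof. by move=> u v Suv E _ _; exact. Qed.

Lemma tjoin_sym R S u v : tjoin R S u v -> tjoin R S v u.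
Proof.
by move=> uv E eE RE SE; have [_ Es _] := eE; apply: Es; exact: uv.
Qed.

Lemma tjoin_trans R S v u w : tjoin R S u v -> tjoin R S v w -> tjoin R S u w.
Proof.
move=> uv vw E eE RE SE; have [_ _ Et] := eE.
by apply: (Et v); [exact: uv|exact: vw].
Qed.

Lemma theory_tjoin R S : theory R -> theory S -> theory (tjoin R S).
Proof.
move=> tR tS.
(* Equivalences pull back along [g]; right multiplications and substitutions in place of [g] give
   the compatibility clauses. *)
have pull g : (forall a b, R a b -> R (g a) (g b)) ->
    (forall a b, S a b -> S (g a) (g b)) ->
    forall u v, tjoin R S u v -> tjoin R S (g u) (g v).
  move=> Rg Sg u v uv E [Er Es Et] RE SE.
  apply: (uv (fun a b => E (g a) (g b))) => [|a b /Rg /RE //|a b /Sg /SE //].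
  by split=> [a|a b|b a c]; [exact: Er|exact: Es|exact: Et].
split=> [u v uv|u v|v u w|u v w|f u v nf|v v0].
- by apply: tjoinl; exact: theory_perm.
- exact: tjoin_sym.
- exact: tjoin_trans.
- by apply: (pull (cat^~ w)) => a b; exact: theory_cat.
- by apply: (pull (subst f)) => a b; exact: theory_subst.
- apply/eqP; rewrite -(v0 (fun a b => (a == [::]) = (b == [::]))) //.
  + by split=> [//|a b ->|b a c -> ->].
  + by move=> a b; exact: theory_nilE.
  + by move=> a b; exact: theory_nilE.
Qed.

(* Corresponds to lower-modularity of varieties, since passing to theories
   reverses the order. *)
Definition upper_modular (A : seq nat -> seq nat -> Prop) : Prop :=
  forall B C, theory B -> theory C -> subtheory B A ->
    subtheory (tmeet A (tjoin B C)) (tjoin B (tmeet A C)).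

(** * Fully invariant ideals and their Rees congruences *)

Record ideal (K : seq nat -> Prop) : Prop := Ideal {
  ideal_perm : forall u v, perm_eq u v -> K u -> K v;
  ideal_cat : forall u v, K u -> K (u ++ v);
  ideal_subst : forall f u, nonerasing f -> K u -> K (subst f u);
  ideal_nil : ~ K [::]
}.

Definition rees (K : seq nat -> Prop) u v : Prop := perm_eq u v \/ K u /\ K v.

Lemma theory_rees K : ideal K -> theory (rees K).
Proof.
move=> iK; split=> [u v|u v [uv|[]]|v u w [uv|[Ku Kv]] [vw|[Kv' Kw]]
                   |u v w [uv|[]]|f u v nf [uv|[]]|v [uv|[]]].
- by left.
- by left; rewrite perm_sym.
- by right.
- by left; exact: perm_trans vw.
- by right; split=> //; apply: ideal_perm Kv' => //; rewrite perm_sym.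
- by right; split=> //; exact: ideal_perm Kv.
- by right.
- by left; rewrite perm_cat2r.
- by right; split; exact: ideal_cat.
- by left; exact: perm_subst.
- by right; split; exact: ideal_subst.
- by apply/eqP; rewrite -size_eq0 -(perm_size uv).
- by move=> /(ideal_nil iK).
Qed.

Definition ideal_gen (g : seq nat) (u : seq nat) : Prop :=
  exists f t, nonerasing f /\ perm_eq u (subst f g ++ t).

Lemma ideal_ideal_gen g : g <> [::] -> ideal (ideal_gen g).
Proof.
move=> g0; split=> [u v uv [f [t [nf ut]]]|u v [f [t [nf ut]]]
                   |h u nh [f [t [nf ut]]]|[f [t [nf]]]].
- by exists f, t; split=> //; rewrite -(permPl uv).
- by exists f, (t ++ v); split=> //; rewrite catA perm_cat2r.
- exists (subst h \o f), (subst h t); split.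
    by move=> i; apply: subst_neq0 => //; exact: nf.
  by rewrite -subst_comp -subst_cat perm_subst.
- rewrite perm_sym => /perm_nilP; case: (subst f g) (subst_neq0 nf g0) => //.
Qed.

Lemma ideal_gen_self g u : perm_eq u g -> ideal_gen g u.
Proof.
move=> ug; exists (fun x => [:: x]), [::]; split=> //.
by rewrite cats0 subst_id.
Qed.

(** Serves to show that a word lies outside the ideal. One letter from each of the images of 0 and 1
    gives the bounds, which add up when these letters coincide. *)
Lemma ideal_gen2 p q u : ideal_gen (nseq p 0 ++ nseq q 1) u ->
  exists y z, forall x,
    p * (y == x) + q * (z == x) <= count_mem x u.
Proof.
move=> [f [t [nf ut]]].
have [y fy] : exists y, y \in f 0.
  by case: (f 0) (nf 0) => // y s _; exists y; rewrite mem_head.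
have [z fz] : exists z, z \in f 1.
  by case: (f 1) (nf 1) => // z s _; exists z; rewrite mem_head.
have le_count w x a : w \in a -> (w == x) <= count_mem x a.
  by case: eqVneq => // <-; rewrite -has_pred1 has_count.
exists y, z => x.
rewrite (permP ut) subst_cat !subst_nseq !count_cat !count_pow.
by apply: leq_trans (leq_addr _ _); rewrite leq_add// leq_mul2l le_count ?orbT.
Qed.

(** * Periodicity *)

(* The clause on [size u == l] makes this invariant under substitutions: as soon
   as some letter is replaced by a longer word, both sides, having the same
   letters, become longer than [l]. *)
Definition coarse (l t : nat) (u v : seq nat) : Prop :=
  perm_eq u v \/
  [/\ l <= size u, l <= size v, (size u == l) = (size v == l)
    & forall x, minn t (count_mem x u) = minn t (count_mem x v)].

(** If a letter [z] with [x] in [f z] has different exponents in [u] and [v], both are at least [t],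
    and so are those of [x] in the images; otherwise the latter are equal. *)
Lemma count_subst_minn t f u v x :
  (forall z, minn t (count_mem z u) = minn t (count_mem z v)) ->
  minn t (count_mem x (subst f u)) = minn t (count_mem x (subst f v)).
Proof.
move=> uv.
have [[z xz zuv]|uv_eq] :=
    pselect (exists2 z, x \in f z & count_mem z u <> count_mem z v).
  have := uv z; have := leq_count_subst u xz; have := leq_count_subst v xz.
  by lia.
rewrite (@count_subst_eq f u v)// => z xz.
by apply: contrapT => zuv; apply: uv_eq; exists z.
Qed.

Lemma theory_coarse l t : 0 < l -> 0 < t -> theory (coarse l t).
Proof.
move=> l0 t0; split.
- by move=> u v; left.
- move=> u v [uv|[lu lv luv uv]]; first by left; rewrite perm_sym.
  by right; split=> //; rewrite -uv.
- move=> v u w [uv|[lu lv luv uv]].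
    case=> [vw|[lv lw lvw vw]]; first by left; exact: perm_trans vw.
    right; rewrite (perm_size uv); split=> // x.
    by rewrite (permP uv) vw.
  case=> [vw|[_ lw lvw vw]]; right.
    by rewrite -(perm_size vw); split=> // x; rewrite -(permP vw).
  by split=> //; [rewrite luv|move=> x; rewrite uv].
- move=> u v w [uv|[lu lv luv uv]]; first by left; rewrite perm_cat2r.
  right; rewrite !size_cat; split; try lia.
  by move=> x; rewrite !count_cat; have := uv x; lia.
- move=> f u v nf [uv|[lu lv luv uv]]; first by left; exact: perm_subst.
  have lsu := leq_size_subst u nf; have lsv := leq_size_subst v nf.
  right; split; [lia|lia| |by move=> x; exact: count_subst_minn].
  have [ul|ul] := eqVneq (size u) l; last first.
    by move: luv; rewrite (negPf ul) => /esym/negbT vl; lia.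
  have vl : size v = l by apply/eqP; rewrite -luv ul.
  rewrite -[in LHS]ul -[in RHS]vl !eq_size_subst//; apply: eq_all_r => x.
  by rewrite -!has_pred1 !has_count; have := uv x; lia.
- by move=> v [|[]]; [move/perm_size; case: v|move=> /=; lia].
Qed.

(* The only steps of a chain for [tjoin (tmeet A (rees K)) (tmeet A C)] that
   can start from a word outside [K] are those of [tmeet A C]. *)
Lemma upper_modular_step A C K u v c d :
  theory A -> theory C -> ideal K -> upper_modular A ->
  A u v -> C u c -> A c d -> C d v -> K c -> K d -> ~ K u -> ~ perm_eq u v ->
  exists w, [/\ ~ perm_eq u w, A u w & C u w].
Proof.
move=> tA tC iK mA Auv Cuc Acd Cdv Kc Kd nKu nuv; apply: contrapT => now.
have step w : A u w -> C u w -> perm_eq u w.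
  by move=> Auw Cuw; apply: contrapT => nuw; apply: now; exists w.
have nKperm a : K a -> perm_eq u a = false.
  move=> Ka; apply/negP => ua; apply/nKu/(ideal_perm iK _ Ka).
  by rewrite perm_sym.
pose B := tmeet A (rees K); have tB : theory B.
  by apply: theory_tmeet => //; exact: theory_rees.
have tABC := theory_tjoin tB tC.
have : tjoin B (tmeet A C) u v.
  apply: mA => //; first by move=> ? ? [].
  split=> //; apply: (theory_trans tABC (tjoinr Cuc)).
  apply: (theory_trans tABC _ (tjoinr Cdv)).
  by apply: tjoinl; split=> //; right.
(* The equivalence separating the words equal to [u] from all others contains [B] and, by [step],
   [tmeet A C], but not the pair of [u] and [v]. *)
move=> /(_ (fun a b => perm_eq u a = perm_eq u b)).
rewrite perm_refl => E; apply/nuv/esym/E => {E}.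
- by split=> [//|a b ->|b a e -> ->].
- by move=> a b [_ [ab|[Ka Kb]]]; [rewrite (permPr ab)|rewrite !nKperm].
- move=> a b [Aab Cab]; apply/idP/idP => [ua|ub]; apply: step.
  + exact: theory_trans (theory_perm tA ua) Aab.
  + exact: theory_trans (theory_perm tC ua) Cab.
  + exact: theory_trans (theory_perm tA ub) (theory_sym tA Aab).
  + exact: theory_trans (theory_perm tC ub) (theory_sym tC Cab).
Qed.

(** * Relations between powers of one letter *)

Lemma size_subst_double y u :
  size (subst (fun z => if z == y then [:: y; y] else [:: z]) u) =
  size u + count_mem y u.
Proof.
elim: u => //= z u IHu; rewrite /subst /= size_cat -/(subst _ _) IHu.
by case: eqP => /=; lia.
Qed.

Lemma theory_size A u v x : theory A -> A u v ->
  A (nseq (size u) x) (nseq (size v) x).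
Proof.
move=> tA Auv; rewrite -!(@subst_const (fun=> [:: x]))//.
exact: theory_subst.
Qed.

(** If the lengths agree, doubling a letter with distinct exponents makes them differ; then all
    letters are sent to 0. *)
Lemma periodic_neq A u v : theory A -> A u v -> ~ perm_eq u v ->
  exists n m, 0 < m /\ A (nseq n 0) (nseq (n + m) 0).
Proof.
move=> tA Auv nuv.
have [a [b [Aab ab]]] : exists a b, A a b /\ size a <> size b.
  have [uv|/eqP uv] := eqVneq (size u) (size v); last by exists u, v.
  have [y yuv] := nperm_eqP nuv.
  pose f z := if z == y then [:: y; y] else [:: z].
  exists (subst f u), (subst f v).
  split; last by rewrite !size_subst_double; lia.
  by apply: theory_subst => // z; rewrite /f; case: ifP.
wlog lab : a b Aab ab / size a < size b.
  move=> H; have [|] := ltnP (size a) (size b); first exact: H Aab ab.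
  rewrite leq_eqVlt => /orP[/eqP/esym//|].
  by apply: H (theory_sym tA Aab) _ => /esym.
exists (size a), (size b - size a); split; first lia.
by rewrite subnKC 1?ltnW//; exact: theory_size.
Qed.

Lemma aperiodic A : theory A -> upper_modular A ->
  (exists u v, A u v /\ ~ perm_eq u v) ->
  exists N, A (nseq N 0) (nseq N.+1 0).
Proof.
move=> tA mA [u0 [v0 [Auv0 nuv0]]].
have [n [m [m0 Anm]]] := periodic_neq tA Auv0 nuv0.
(* [coarse] identifies 0^a 1^a only with 0^(a+1) 1^(a-1) and 0^(a-1) 1^(a+1);
   an A-relation between these yields, by doubling 1, powers of 0 whose
   exponents differ by one. *)
pose a := n + m + 2; have a2 : 1 < a by rewrite /a; lia.
pose X p q := nseq p 0 ++ nseq q 1.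
have cX p q x : count_mem x (X p q) = (0 == x) * p + (1 == x) * q.
  by rewrite count_cat !count_nseq.
have sX p q : size (X p q) = p + q by rewrite size_cat !size_nseq.
have AX p q : n <= p -> A (X p q) (X (p + m) q).
  move=> np; apply: theory_cat => //.
  rewrite -(subnK np) -addnA ![nseq (p - n + _) _]nseqD.
  exact: theory_catl.
have KX p q : a < p -> ideal_gen (nseq a.+1 0 ++ nseq 0 1) (X p q).
  move=> ap; rewrite /X -(subnKC ap) nseqD -catA; apply: ideal_cat.
    exact: ideal_ideal_gen.
  by apply: ideal_gen_self; rewrite cats0.
(* The four words form a square: adding [m] letters 0 is an [A]-step, the exponent of 0 being at
   least [n], and trading one 1 for a 0 is a [coarse] step. No exponent in [X a a] exceeds [a],
   which keeps it out of the ideal. *)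
have [] := @upper_modular_step A (coarse (2 * a) a.-1)
    (ideal_gen (nseq a.+1 0 ++ nseq 0 1)) (X a a) (X (a + m) a)
    (X a.+1 a.-1) (X (a.+1 + m) a.-1) => //.
- by apply: theory_coarse; rewrite /a; lia.
- exact: ideal_ideal_gen.
- by apply: AX; rewrite /a; lia.
- right; rewrite !sX; split; [lia|rewrite /a; lia|rewrite /a; lia|].
  by move=> x; rewrite !cX; do 2 case: eqP => _; rewrite /a; lia.
- by apply: AX; rewrite /a; lia.
- right; rewrite !sX; split; [rewrite /a; lia|lia|rewrite /a; lia|].
  by move=> x; rewrite !cX; do 2 case: eqP => _; rewrite /a; lia.
- exact: KX.
- by apply: KX; lia.
- move=> /ideal_gen2[y [z /(_ y)]]; rewrite eqxx cX.
  by have [<-|] := eqVneq 0 y; case: eqP => /=; lia.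
- by move=> /perm_size; rewrite !sX; lia.
move=> w [nw Aw [//|[lw lw2 /esym]]]; rewrite sX.
have -> : a + a == 2 * a by apply/eqP; lia.
move=> /eqP sw cw.
(* The threshold [a.-1] is positive, so [coarse] preserves contents and [w] has no letters besides 0
   and 1. *)
have wX : perm_eq w (X (count_mem 0 w) (count_mem 1 w)).
  apply/perm_eqP => x; rewrite cX; have := cw x; rewrite cX.
  have [<- _|_] := eqVneq 0 x; first by rewrite mul1n mul0n addn0.
  have [<- _|_] := eqVneq 1 x; first by rewrite mul1n.
  by rewrite /a; lia.
have := perm_size wX; rewrite sw sX => cw2.
have cwa : count_mem 0 w <> a.
  move=> wa; apply: nw; rewrite perm_sym.
  have wa1 : count_mem 1 w = a by lia.
  by rewrite wa wa1 in wX.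
have c0 : a.-1 <= count_mem 0 w by have := cw 0; rewrite cX; lia.
have c1 : a.-1 <= count_mem 1 w by have := cw 1; rewrite cX; lia.
pose f z := if z == 1 then [:: 1; 1] else [:: z].
have nf : nonerasing f by move=> z; rewrite /f; case: ifP.
have := theory_size 0 tA (theory_subst tA nf Aw).
rewrite !size_subst_double sX cX sw mul0n mul1n => Aw2.
have [w1|w1] : count_mem 1 w = a.+1 \/ count_mem 1 w = a.-1 by lia.
  exists (3 * a); have -> : (3 * a).+1 = 2 * a + count_mem 1 w by lia.
  by have -> : 3 * a = a + a + (0 + a) by lia.
exists (3 * a).-1; apply: (theory_sym tA).
have -> : (3 * a).-1.+1 = a + a + (0 + a) by lia.
by have -> : (3 * a).-1 = 2 * a + count_mem 1 w by lia.
Qed.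

(** * Absorbed letters *)

Definition absorbs (R : seq nat -> seq nat -> Prop) (u : seq nat) (x : nat) :
  Prop := R u (x :: u).

Lemma absorbs_eq R u v x : theory R -> R u v -> absorbs R u x -> absorbs R v x.
Proof.
move=> tR Ruv Rux; apply: (theory_trans tR (theory_sym tR Ruv)).
exact: (theory_trans tR Rux (theory_cons x tR Ruv)).
Qed.

Lemma absorbs_catr R u v x :
  theory R -> absorbs R u x -> absorbs R (u ++ v) x.
Proof. by move=> tR Rux; exact: (theory_cat tR v Rux). Qed.

Lemma absorbs_word R u t : theory R -> {in t, forall x, absorbs R u x} ->
  R u (t ++ u).
Proof.
move=> tR; elim: t => [_|x t IHt xt]; first exact: theory_perm.
apply: (theory_trans tR (IHt _)).
  by move=> y yt; apply: xt; rewrite inE yt orbT.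
apply: absorbs_eq (IHt _) (xt x (mem_head _ _)) => // y yt.
by apply: xt; rewrite inE yt orbT.
Qed.

Lemma absorbs_count R N u x : theory R -> R (nseq N 0) (nseq N.+1 0) ->
  N <= count_mem x u -> absorbs R u x.
Proof.
move=> tR RN Nu.
have RNx : R (nseq N x) (nseq N.+1 x).
  by have := theory_size x tR RN; rewrite !size_nseq.
have ux : perm_eq u
    (nseq N x ++ (nseq (count_mem x u - N) x ++ filter (predC1 x) u)).
  by rewrite catA -nseqD subnKC// perm_count_split.
apply: (theory_trans tR (theory_perm tR ux)).
apply: (theory_trans tR (theory_cat tR _ RNx)).
by apply: theory_perm => //=; rewrite perm_cons perm_sym.
Qed.

(** For positive [M], congruence of exponents alone would relate [M]-th powers to the empty word;
    equality of contents prevents this. *)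
Definition content_modn (M : nat) (u v : seq nat) : Prop :=
  u =i v /\ forall x, count_mem x u = count_mem x v %[mod M].

Lemma theory_content_modn M : theory (content_modn M).
Proof.
split=> [u v uv|u v [uv cuv]|v u w [uv cuv] [vw cvw]|u v w [uv cuv]
         |f u v nf [uv cuv]|v [uv _]].
- by split=> [|x]; [exact: perm_mem|rewrite (permP uv)].
- by split=> [x|x]; rewrite ?uv ?cuv.
- by split=> [x|x]; rewrite ?uv ?cuv.
- split=> [x|x]; first by rewrite !mem_cat uv.
  by rewrite !count_cat -modnDml cuv modnDml.
- by split=> [|x]; [exact: subst_content|exact: count_subst_modn].
- by case: v uv => // x v /(_ x); rewrite mem_head.
Qed.

Definition unabsorbed_eq (R : seq nat -> seq nat -> Prop) (u v : seq nat) :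
    Prop :=
  R u v /\ forall x, count_mem x u = count_mem x v \/ absorbs R u x.

(** For substitutions: if the exponents of [z] differ, [u] absorbs the [N]-th power of [z], so the
    image of [u] is related to a multiple of the [N]-th power of [f z], which contains every letter
    of [f z] at least [N] times. *)
Lemma theory_unabsorbed_eq R N : theory R -> R (nseq N 0) (nseq N.+1 0) ->
  theory (unabsorbed_eq R).
Proof.
move=> tR RN; split=> [u v uv|u v [Ruv uv]|v u w [Ruv uv] [Rvw vw]
                      |u v w [Ruv uv]|f u v nf [Ruv uv]|v [/(theory_nil tR)]//].
- by split=> [|x]; [exact: theory_perm|left; exact/permP].
- split=> [|x]; first exact: theory_sym.
  by have [->|ux] := uv x; [left|right; exact: absorbs_eq ux].
- split=> [|x]; first exact: theory_trans Rvw.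
  have [->|ux] := uv x; last by right.
  have [->|vx] := vw x; first by left.
  by right; apply: absorbs_eq vx => //; exact: theory_sym.
- split=> [|x]; first exact: theory_cat.
  have [ux|ux] := uv x; last by right; exact: absorbs_catr.
  by left; rewrite !count_cat ux.
- split=> [|x]; first exact: theory_subst.
  have [[z xz zuv]|uv_eq] :=
      pselect (exists2 z, x \in f z & count_mem z u <> count_mem z v);
      last first.
    left; apply: count_subst_eq => z xz.
    by apply: contrapT => zuv; apply: uv_eq; exists z.
  have [//|uz] := uv z; right.
  have Ruzu : R u (nseq N z ++ u).
    by apply: absorbs_word => // y; rewrite mem_nseq => /andP[_ /eqP ->].
  have Rfu := theory_subst tR nf Ruzu; rewrite subst_cat subst_nseq in Rfu.
  apply: (absorbs_eq tR (theory_sym tR Rfu)); apply: absorbs_count RN _ => //.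
  rewrite count_cat count_pow; apply: leq_trans (leq_addr _ _).
  by rewrite leq_pmulr// -has_count has_pred1.
Qed.

Lemma absorbs_neq_count A N u v x : theory A -> upper_modular A ->
  A (nseq N 0) (nseq N.+1 0) -> A u v -> u =i v ->
  count_mem x u <> count_mem x v -> absorbs A u x.
Proof.
move=> tA mA AN Auv uv xuv.
(* Multiplying by the large power [f] of [u] preserves exponents modulo [M] and
   makes all letters of [u] absorbed. *)
pose M := (size u + size v).+1; pose f := pow (M * N) u.
have tB := theory_unabsorbed_eq tA AN; have tC := theory_content_modn M.
have tBC := theory_tjoin tB tC.
have mulM y : y \in f -> y \in u.
  by rewrite -!has_pred1 !has_count count_pow muln_gt0 => /andP[].
have Cf w : w =i u -> content_modn M w (w ++ f).
  move=> wu; split=> y.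
    rewrite mem_cat wu; have [//|yu] := boolP (y \in u).
    by apply/esym/negP => /mulM; exact/negP.
  by rewrite count_cat count_pow -mulnA [M * _]mulnC addnC modnMDl.
have Bf : unabsorbed_eq A (u ++ f) (v ++ f).
  split=> [|y]; first exact: theory_cat.
  have [yu|yu] := boolP (y \in u); last first.
    by left; rewrite !count_cat (count_memPn yu) (@count_memPn _ y v _)// -uv.
  right; apply: absorbs_count AN _ => //; rewrite count_cat count_pow.
  apply: leq_trans (leq_addl _ _); rewrite [M * N]mulnC -mulnA leq_pmulr//.
  by rewrite muln_gt0/= -has_count has_pred1.
have : tjoin (unabsorbed_eq A) (tmeet A (content_modn M)) u v.
  apply: mA => //; first by move=> ? ? [].
  split=> //; apply: (theory_trans tBC (tjoinr (Cf u _))) => //.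
  apply: (theory_trans tBC _ (theory_sym tBC (tjoinr (Cf v _)))).
    exact: tjoinl.
  by move=> y; rewrite uv.
(* Along a chain, exponents change modulo [M] only at absorbed letters. As [M] exceeds both lengths,
   congruent exponents in [u] and [v] are equal. *)
pose E a b := A a b /\
  forall y, count_mem y a = count_mem y b %[mod M] \/ absorbs A a y.
move=> /(_ E)[].
- split=> [a|a b [Aab ab]|b a c [Aab ab] [Abc bc]].
  + by split=> [|y]; [exact: theory_perm|left].
  + split=> [|y]; first exact: theory_sym.
    by have [->|ay] := ab y; [left|right; exact: absorbs_eq ay].
  + split=> [|y]; first exact: theory_trans Abc.
    have [->|ay] := ab y; last by right.
    have [->|ya] := bc y; first by left.
    by right; apply: absorbs_eq ya => //; exact: theory_sym.
- by move=> a b [Aab ab]; split=> // y; have [->|] := ab y; [left|right].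
- by move=> a b [Aab [_ ab]]; split=> // y; left.
- move=> _ /(_ x)[|//]; rewrite !modn_small// ltnS.
  + by rewrite (leq_trans (count_size _ _))// leq_addl.
  + by rewrite (leq_trans (count_size _ _))// leq_addr.
Qed.

(** Otherwise, join the nonempty unabsorbed part [s] of [u] to a large power of [x]. Words related
    by [A] to this product [u1] differ from it at most in the exponent of [x], yet
    [upper_modular_step] yields a different one of the same length. *)
Lemma absorbs_content A N u x y : theory A -> upper_modular A ->
  A (nseq N 0) (nseq N.+1 0) -> homotypical A ->
  x \in u -> absorbs A u x -> y \in u -> absorbs A u y.
Proof.
move=> tA mA AN hA xu ux yu; apply: contrapT => nuy.
pose a z := ~~ `[<absorbs A u z>]; pose s := filter a u.
have sP z : reflect (z \in u /\ ~ absorbs A u z) (z \in s).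
  rewrite mem_filter; apply: (iffP andP) => [[/asboolPn ? ?]|[? /asboolPn ?]].
    by split.
  by split.
have s0 : s <> [::] by move=> s0; have /sP := conj yu nuy; rewrite s0.
have [y0 y0s y0max] := ex_max_count s0.
(* Large enough that [c] below, with one [x] fewer, still absorbs [x], and that no letter of [s]
   reaches the exponent [p.-1]. *)
pose p := N + size s + 2; pose u1 := nseq p x ++ s.
have xs : x \notin s by apply/negP => /sP[].
have y0x : y0 == x = false by apply: contraNF xs => /eqP <-.
have cs z : count_mem z s <= size s := count_size _ _.
have q0 : 0 < count_mem y0 s by rewrite -has_count has_pred1.
have cx : count_mem x s = 0 by apply/count_memPn.
(* Since [u] absorbs [x], it is related to a multiple of [u1], so it absorbs whatever [u1]
   absorbs. *)
have nabs z : z \in s -> ~ absorbs A u1 z.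
  move=> /sP[zu nuz] u1z; apply: nuz.
  have Au : A u (u1 ++ filter (predC a) u).
    apply: (theory_trans tA (@absorbs_word _ _ (nseq p x) tA _)).
      by move=> w; rewrite mem_nseq => /andP[_ /eqP ->].
    by apply: theory_perm; rewrite // -catA perm_cat2l perm_sym perm_filterC.
  by apply: (absorbs_eq tA (theory_sym tA Au)); exact: absorbs_catr.
have c1 z : count_mem z u1 = (x == z) * p + count_mem z s.
  by rewrite count_cat count_nseq.
have su1 : size u1 = p + size s by rewrite size_cat size_nseq.
(* [c] comes from [u1] by replacing one [x] by [y0].  The maximality of [y0] in
   [s] keeps [u1] out of the ideal [K] generated by a word dividing [c]. *)
pose c := nseq p.-1 x ++ (y0 :: s).
have cc z : count_mem z c = (x == z) * p.-1 + ((y0 == z) + count_mem z s).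
  by rewrite count_cat count_nseq.
have sc : size c = p.-1 + (size s).+1 by rewrite size_cat size_nseq.
have dc : perm_eq (x :: c) (y0 :: u1).
  apply/perm_eqP => z /=; rewrite cc c1 /p; do 2 case: eqP => _; lia.
pose K := ideal_gen (nseq p.-1 0 ++ nseq (count_mem y0 s).+1 1).
have iK : ideal K.
  by apply: ideal_ideal_gen; rewrite /p addn2.
have Kc : K c.
  exists (fun z => if z == 0 then [:: x] else [:: y0]), (filter (predC1 y0) s).
  split; first by move=> z; case: ifP.
  rewrite subst_cat !subst_nseq /= (pow_nseq _ 1) (pow_nseq _ 1) !muln1 -catA.
  by rewrite perm_cat2l /= perm_cons perm_count_split.
have [] := @upper_modular_step A (coarse (size u1) 1) K
    u1 (x :: u1) c (y0 :: u1) tA _ iK mA.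
- by apply: theory_coarse; rewrite // su1 /p; lia.
- by apply: absorbs_count AN _ => //; rewrite c1 eqxx /p; lia.
- right; split; [by []|rewrite sc su1 /p; lia|rewrite sc su1 /p; lia|].
  move=> z; rewrite c1 cc; have [<-|_] := eqVneq x z; first by rewrite /p; lia.
  by have [<-|_] := eqVneq y0 z; lia.
- apply: (theory_trans tA _ (theory_perm tA dc)).
  by apply: absorbs_count AN _ => //; rewrite cc eqxx /p; lia.
- right; split=> //=; try lia.
  move=> z; rewrite /= c1; have [<-|_] := eqVneq x z; first by rewrite /p; lia.
  by have [<-|_] := eqVneq y0 z; lia.
- by [].
- by apply: (ideal_perm iK) (ideal_cat iK [:: x] Kc); rewrite cats1 perm_rcons.
(* Only [x] can have an exponent of at least [p.-1], or one above the maximum in [s]. Serving for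
   both letters of the generator, it falls short by the exponent of [y0] in [s]. *)
- move=> /ideal_gen2[b [e be]]; have := be b; have := be e.
  rewrite !c1 !eqxx; have := cs b; have := y0max e.
  have [xb|xb] := eqVneq x b; have [xe|xe] := eqVneq x e;
    try subst b; try subst e.
  + by rewrite eqxx cx; lia.
  + by lia.
  + by rewrite /p; lia.
  + by rewrite /p; lia.
- by move=> /perm_size /=; lia.
move=> w [nw Aw [//|[_ _ swE _]]].
have sw : size w = size u1 by apply/eqP; rewrite -swE.
have cw z : z != x -> count_mem z u1 = count_mem z w.
  move=> zx; have [//|/eqP nzw] := eqVneq (count_mem z u1) (count_mem z w).
  have u1z := absorbs_neq_count tA mA AN Aw (hA _ _ Aw) nzw.
  have zs : z \notin s by apply/negP => /nabs.
  have zu1 : z \notin u1 by rewrite mem_cat mem_nseq (negPf zx) andbF.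
  by rewrite (count_memPn zu1) (@count_memPn _ z w _)// -(hA _ _ Aw).
have fw : perm_eq (filter (predC1 x) u1) (filter (predC1 x) w).
  apply/perm_eqP => z; rewrite !count_filter.
  have [->|zx] := eqVneq z x.
    have E b : predI (pred1 x) (predC1 x) b = pred0 b by rewrite /=; case: eqP.
    by rewrite !(eq_count E) !count_pred0.
  have E b : predI (pred1 z) (predC1 x) b = pred1 z b.
    by rewrite /=; case: eqP => // ->.
  by rewrite !(eq_count E) cw.
have xw : count_mem x u1 = count_mem x w.
  have := perm_size (perm_count_split x u1).
  rewrite -sw (perm_size (perm_count_split x w)) !size_cat !size_nseq.
  by rewrite (perm_size fw) => /addIn.
by apply: nw; apply/perm_eqP => z; have [->|/cw] := eqVneq z x.
Qed.

(** Substituting [y :: t] for [y] fixes [u] and multiplies [v] by the power of [t] whose exponent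
    [j] is that of [y] in [v]. *)
Lemma pow_absorbing R u v y : theory R -> R u v -> y \notin u -> y \in v ->
  exists2 j, 0 < j &
    forall t, R u (u ++ pow j t) /\ R v (v ++ pow j t).
Proof.
move=> tR Ruv yu yv; pose j := count_mem y v; pose v' := filter (predC1 y) v.
have vE := perm_count_split y v.
exists j => [|t]; first by rewrite -has_count has_pred1.
pose f z := if z == y then y :: t else [:: z].
have nf : nonerasing f by move=> z; rewrite /f; case: ifP.
have fu : subst f u = u.
  by apply: subst_id => z zu; rewrite /f; case: eqP zu yu => // -> ->.
have fv' : subst f v' = v'.
  by apply: subst_id => z; rewrite mem_filter /f /= => /andP[/negPf ->].
have Ruvt : R u (v ++ pow j t).
  have := theory_subst tR nf Ruv; rewrite fu => Ru.
  apply: (theory_trans tR Ru); apply: theory_perm => //.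
  apply: (perm_trans (perm_subst f vE)).
  rewrite subst_cat subst_nseq {1}/f eqxx fv'.
  apply: (@perm_trans _ ((nseq j y ++ pow j t) ++ v')).
    by rewrite perm_cat2r pow_cons.
  by rewrite perm_catAC perm_cat2r perm_sym.
have Rvt := theory_cat tR (pow j t) Ruv; split.
  by apply: (theory_trans tR Ruvt); exact: theory_sym.
exact: (theory_trans tR (theory_sym tR Ruv) Ruvt).
Qed.

Lemma heterotypical_pow R u v : theory R -> R u v -> ~ (u =i v) ->
  exists2 j, 0 < j &
    forall t, R u (u ++ pow j t) /\ R v (v ++ pow j t).
Proof.
move=> tR Ruv /neq_contentP[y]; have [yu|yu] := boolP (y \in u).
  have [//|yv _] := boolP (y \in v).
  have [j j0 jP] := pow_absorbing tR (theory_sym tR Ruv) yv yu.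
  by exists j => // t; have [] := jP t.
have [yv _|//] := boolP (y \in v); exact: pow_absorbing Ruv yu yv.
Qed.

(** A letter occurring on one side only is sent to [x.+1], chosen just to differ from [x], and the
    others to [x]. One side becomes a power of [x], and [pow_absorbing] applies. *)
Lemma heterotypical_nseq R x : theory R -> ~ homotypical R ->
  exists k i, [/\ 0 < k, 0 < i & forall t, R (nseq k x) (nseq k x ++ pow i t)].
Proof.
move=> tR /existsNP[u /existsNP[v /not_implyP[Ruv /neq_contentP[y]]]].
wlog yu : u v Ruv / y \notin u.
  move=> H yuv; have [yu|] := boolP (y \in u); last by move=> /H; apply; eauto.
  apply: (H v u) => //; first exact: theory_sym.
    by apply/negP => yv; apply: yuv; rewrite yu yv.
  by move=> /esym.
rewrite (negPf yu) => yv0; have yv : y \in v by case: (y \in v) yv0.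
pose f z := if z == y then [:: x.+1] else [:: x].
have nf : nonerasing f by move=> z; rewrite /f; case: ifP.
have fu : subst f u = nseq (size u) x.
  by apply: subst_const => z zu; rewrite /f; case: eqP zu yu => // -> ->.
have := theory_subst tR nf Ruv; rewrite fu => Rf.
have [||i i0 iP] := @pow_absorbing _ _ _ x.+1 tR Rf.
- by rewrite mem_nseq; case: eqP => [|_]; [lia|rewrite andbF].
- by apply/mem_substP; exists y => //; rewrite /f eqxx mem_head.
exists (size u), i; split=> // [|t]; last by have [] := iP t.
rewrite lt0n size_eq0 (theory_nilE tR Ruv) -size_eq0 -lt0n.
by case: v yv {Ruv yv0 Rf iP}.
Qed.

(** * Classification and modularity *)

Definition rees_theory (A : seq nat -> seq nat -> Prop) : Prop :=
  exists Z, forall u v, A u v <-> rees Z u v.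

Definition content_rees_theory (A : seq nat -> seq nat -> Prop) : Prop :=
  exists2 Z : seq nat -> Prop, forall u t, Z u -> Z (u ++ t) &
    forall u v, A u v <-> perm_eq u v \/ [/\ Z u, Z v & u =i v].

Lemma upper_modular_rees A : theory A -> upper_modular A ->
  rees_theory A \/ content_rees_theory A.
Proof.
move=> tA mA.
have [triv|ntriv] := pselect (forall u v, A u v -> perm_eq u v).
  left; exists (fun=> False) => u v; split=> [/triv|[|[]]//]; first by left.
  exact: theory_perm.
have [N AN] : exists N, A (nseq N 0) (nseq N.+1 0).
  apply: aperiodic => //; apply: contrapT => H; apply: ntriv => u v Auv.
  by apply: contrapT => nuv; apply: H; exists u, v.
have abs_pow u w i y : 0 < i -> A u (w ++ pow i (nseq N y)) -> absorbs A u y.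
  move=> i0 Au; apply: (absorbs_eq tA (theory_sym tA Au)).
  apply: absorbs_count AN _ => //; rewrite count_cat pow_nseq count_nseq /=.
  by rewrite eqxx mul1n; apply: leq_trans (leq_addl _ _); rewrite leq_pmull.
have abs_nseq u x k : absorbs A u x -> A u (nseq k x ++ u).
  move=> ux; apply: absorbs_word => // y.
  by rewrite mem_nseq => /andP[_ /eqP ->].
have [hA|hA] := pselect (homotypical A); [right|left].
  have absC u x : x \in u -> absorbs A u x -> {in u, forall y, absorbs A u y}.
    by move=> xu ux y; exact: absorbs_content AN hA xu ux.
  (* The empty word absorbs all its letters vacuously; excluding it makes this set closed under
     multiples. *)
  exists (fun u => u <> [::] /\ {in u, forall x, absorbs A u x}) 
    => [u t [u0 uZ]|u v].
    case: u u0 uZ => // x u _ xu.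
    split=> //; apply: (absC _ x); first by rewrite mem_head.
    by apply: absorbs_catr => //; apply: xu; rewrite mem_head.
  split=> [Auv|[uv|[[_ uZ] [_ vZ] uv]]].
  - have [uv|/negP/nperm_eqP[x xuv]] := boolP (perm_eq u v); first by left.
    have huv := hA _ _ Auv.
    have ux := absorbs_neq_count tA mA AN Auv huv xuv.
    have vx := absorbs_eq tA Auv ux.
    have xu : x \in u.
      apply: contrapT => /negP xu; apply: xuv.
      by rewrite (count_memPn xu) (@count_memPn _ x v _)// -huv.
    right; split=> //.
      by split; [move=> u0; rewrite u0 in xu|exact: absC xu ux].
    rewrite huv in xu.
    by split; [move=> v0; rewrite v0 in xu|exact: absC xu vx].
  - exact: theory_perm.
  - apply: (theory_trans tA (@absorbs_word _ _ v tA _)).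
      by move=> x; rewrite -uv => /uZ.
    apply: (theory_trans tA (theory_perm tA _)
      (theory_sym tA (@absorbs_word _ _ u tA _))).
      by rewrite perm_catC.
    by move=> x; rewrite uv => /vZ.
(* These are the words representing zero modulo [A]: any two of them are related to their
   product. *)
exists (fun u => forall x, absorbs A u x) => u v.
split=> [Auv|[uv|[uZ vZ]]].
- have [uv|/negP nuv] := boolP (perm_eq u v); first by left.
  suff uZ x : absorbs A u x by right; split=> // x; exact: absorbs_eq Auv _.
  have [uv|nuv'] := pselect (u =i v); last first.
    have [i i0 iP] := heterotypical_pow tA Auv nuv'.
    by have [Au _] := iP (nseq N x); exact: abs_pow i0 Au.
  have [y yuv] := nperm_eqP nuv.
  have uy := absorbs_neq_count tA mA AN Auv uv yuv.
  (* [u] absorbs powers of [y], and a suitable power of [y] absorbs an [i]-th power of any word, in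
     particular of [nseq N x]. *)
  have [k [i [_ i0 kP]]] := heterotypical_nseq y tA hA.
  apply: (abs_pow _ (u ++ nseq k y) i) => //.
  apply: (theory_trans tA (abs_nseq _ _ k uy)).
  rewrite -catA.
  apply: (theory_trans tA (theory_perm tA _) (theory_catl u tA (kP _))).
  by rewrite perm_catC.
- exact: theory_perm.
- apply: (theory_trans tA (@absorbs_word _ _ v tA _)) => //.
  apply: (theory_trans tA (theory_perm tA _)
      (theory_sym tA (@absorbs_word _ _ u tA _))) => //.
  by rewrite perm_catC.
Qed.

Definition modular_theory (A : seq nat -> seq nat -> Prop) : Prop :=
  forall B C, theory B -> theory C -> subtheory B C ->
    subtheory (tmeet (tjoin A B) C) (tjoin (tmeet A C) B).

(** A nontrivial [A]-step joins two words of [Z], so a chain either stays within [B] or can be cut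
    short between its first and last visits to [Z]. *)
Lemma tjoin_rees A B Z u v : theory A -> theory B -> subtheory A (rees Z) ->
  tjoin A B u v -> B u v \/ exists a b, [/\ Z a, Z b, B u a & B v b].
Proof.
move=> tA tB AZ.
have Bsym a b : B a b -> B b a by exact: theory_sym.
have Btrans a b c : B a b -> B b c -> B a c by exact: theory_trans.
have Bperm a b : perm_eq a b -> B a b by exact: theory_perm.
pose E a b := B a b \/ exists c d, [/\ Z c, Z d, B a c & B b d].
apply: (_ : tjoin A B u v -> E u v); apply=> [|a b /AZ[/Bperm|[Za Zb]]|a b].
- split=> [a|a b [/Bsym|[c [d []]]]|b a c [ab|[z [w [Zz Zw az bw]]]]
                                       [bc|[z' [w' [Zz' Zw' bz' cw']]]]].
  - by left; exact: Bperm.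
  - by left.
  - by right; exists d, c.
  - by left; exact: Btrans bc.
  - by right; exists z', w'; split=> //; exact: Btrans bz'.
  - by right; exists z, w; split=> //; apply: Btrans bw; exact: Bsym.
  - by right; exists z, w'.
- by left.
- by right; exists a, b; split=> //; exact: Bperm.
- by left.
Qed.

Lemma tjoin_homotypical A B : homotypical A -> homotypical B ->
  homotypical (tjoin A B).
Proof.
move=> hA hB u v /(_ (fun a b => a =i b)); apply=> //.
by split=> [a|a b ab x|b a c ab bc x]; rewrite ?ab ?bc.
Qed.

(** The two words of [Z] given by [tjoin_rees] are related by [A], and also by [C] because [B] is
    contained in [C]. *)
Lemma rees_theory_modular A : theory A -> rees_theory A -> modular_theory A.
Proof.
move=> tA [Z AZ] B C tB tC BC u v [].
move=> /(tjoin_rees tA tB (fun a b => proj1 (AZ a b)))[uv _|].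
  exact: tjoinr.
move=> [a [b [Za Zb ua vb]]] Cuv.
apply: (@tjoin_trans _ _ a); first exact: tjoinr.
apply: (@tjoin_trans _ _ b); last by apply: tjoin_sym; exact: tjoinr.
apply: tjoinl; split; first by apply/AZ; right.
apply: (theory_trans tC (theory_sym tC (BC _ _ ua))).
exact: (theory_trans tC Cuv (BC _ _ vb)).
Qed.

(** The Rees argument applies unless the words [a] and [b] of [Z] differ in content. In that case
    neither [B] nor [C] preserves contents, and both words can be enlarged to a common content. *)
Lemma content_rees_theory_modular A :
  theory A -> content_rees_theory A -> modular_theory A.
Proof.
move=> tA [Z Zcat AZ] B C tB tC BC u v [AB Cuv].
have hA : homotypical A by move=> a b /AZ[/perm_mem|[]].
have AZ' : subtheory A (rees Z) by move=> a b /AZ[|[]]; [left|right].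
have [|[a [b [Za Zb ua vb]]]] := tjoin_rees tA tB AZ' AB; first exact: tjoinr.
have Cab : C a b.
  apply: (theory_trans tC (theory_sym tC (BC _ _ ua))).
  exact: (theory_trans tC Cuv (BC _ _ vb)).
apply: (@tjoin_trans _ _ a); first exact: tjoinr.
apply: (@tjoin_trans _ _ b); last by apply: tjoin_sym; exact: tjoinr.
have [ab|nab] := pselect (a =i b).
  by apply: tjoinl; split=> //; apply/AZ; right.
have hB : ~ homotypical B.
  move=> hB; apply: nab => x; rewrite -(hB _ _ ua) -(hB _ _ vb).
  exact: tjoin_homotypical AB x.
have [j j0 jP] := heterotypical_pow tC Cab nab.
(* Each of [a] and [b] can be multiplied, within [tmeet A C], by a power of one
   of its letters; [B] then makes it absorb a power of the other word. *)
have ext e f : Z e -> e <> [::] -> f <> [::] ->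
    (forall t, C e (e ++ pow j t)) ->
    exists w, [/\ tjoin (tmeet A C) B e w, Z w, C e w & w =i e ++ f].
  case: e => // x e Ze _ f0 Ce.
  have [k [i [k0 i0 kP]]] := heterotypical_nseq x tB hB.
  pose e1 := (x :: e) ++ pow j (nseq k x).
  have Be1 : B e1 (e1 ++ pow i f).
    rewrite /e1 pow_nseq -(subnK (leq_pmull k j0)) nseqD catA -[X in B _ X]catA.
    exact: theory_catl.
  have e1E : e1 =i x :: e.
    move=> y; rewrite mem_cat mem_pow// mem_nseq inE.
    by case: (y == x); rewrite ?andbF ?orbF.
  have Ze1 : Z e1 := Zcat _ _ Ze.
  exists (e1 ++ pow i f); split.
  - apply: (@tjoin_trans _ _ e1); last exact: tjoinr.
    apply: tjoinl; split; last exact: Ce.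
    by apply/AZ; right; split=> // y; rewrite e1E.
  - exact: Zcat.
  - exact: (theory_trans tC (Ce _) (BC _ _ Be1)).
  - by move=> y; rewrite mem_cat e1E mem_pow// mem_cat.
have a0 : a <> [::].
  by move=> a0; apply: nab; move: Cab; rewrite a0 => /(theory_nil tC) ->.
have b0 : b <> [::].
  by move=> b0; move: Cab; rewrite b0 => /(theory_sym tC) /(theory_nil tC).
have [wa [awa Zwa Cwa waE]] := ext a b Za a0 b0 (fun t => proj1 (jP t)).
have [wb [bwb Zwb Cwb wbE]] := ext b a Zb b0 a0 (fun t => proj2 (jP t)).
apply: (tjoin_trans awa); apply: tjoin_trans (tjoin_sym bwb).
apply: tjoinl; split.
  by apply/AZ; right; split=> // y; rewrite waE wbE !mem_cat orbC.
by apply: (theory_trans tC (theory_sym tC Cwa)); exact: (theory_trans tC Cab).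
Qed.

(** * Varieties and congruences *)

Definition omul (S : semigroup) (a b : option S) : option S :=
  match a, b with
  | Some x, Some y => Some (sg_mul x y)
  | None, _ => b
  | _, None => a
  end.

Lemma omulA (S : semigroup) : associative (@omul S).
Proof. by move=> [a|] [b|] [c|] //=; rewrite sg_mulA. Qed.

Lemma omulC (S : semigroup) :
  commutative (@sg_mul S) -> commutative (@omul S).
Proof. by move=> mulC [a|] [b|] //=; rewrite mulC. Qed.

(* The value of a possibly empty word in [S] with a unit [None] adjoined. *)
Definition oeval (S : semigroup) (phi : nat -> S) (s : seq nat) : option S :=
  foldr (fun i => omul (Some (phi i))) None s.

Lemma oeval_cons (S : semigroup) (phi : nat -> S) x s :
  oeval phi (x :: s) = Some (eval phi (x, s)).
Proof.
rewrite /eval /=; elim: s (phi x) => //= y s IHs a.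
by rewrite -IHs; case: (oeval phi s) => [b|] //=; rewrite sg_mulA.
Qed.

Lemma oeval_cat (S : semigroup) (phi : nat -> S) s t :
  oeval phi (s ++ t) = omul (oeval phi s) (oeval phi t).
Proof.
elim: s => //= x s ->; exact: (omulA (Some (phi x))).
Qed.

Lemma oeval_perm (S : semigroup) (phi : nat -> S) s t :
  commutative (@sg_mul S) -> perm_eq s t -> oeval phi s = oeval phi t.
Proof.
move=> mulC st.
apply: (catCA_perm_ind (P := fun s' => oeval phi s' = oeval phi t)) (erefl _).
  move=> s1 s2 s3 <-; rewrite !oeval_cat !omulA.
  by rewrite (omulC mulC (oeval phi s1)).
by rewrite perm_sym.
Qed.

Lemma oeval_subst (S : semigroup) (phi psi : nat -> S) f s :
  (forall i, oeval phi (f i) = Some (psi i)) ->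
  oeval phi (subst f s) = oeval psi s.
Proof.
move=> fpsi; elim: s => // x s IHs.
by rewrite [LHS](oeval_cat phi (f x)) fpsi IHs.
Qed.

(** The fully invariant congruence of [V], extended to the empty word through the adjoined unit. *)
Definition Th (V : Com) (u v : seq nat) : Prop :=
  forall S : semigroup, (V : set semigroup) S ->
  forall phi : nat -> S, oeval phi u = oeval phi v.

(** Belongs to every variety and separates the empty word from all others. *)
Definition unit_semigroup : semigroup :=
  @MkSemigroup unit (fun _ _ => tt) (fun _ _ _ => erefl) (inhabits tt).

Lemma Com_unit (V : Com) : (V : set semigroup) unit_semigroup.
Proof.
have [Sigma ->] := com_variety V => p _ phi.
by case: (eval _ _); case: (eval _ _).
Qed.

Lemma theory_Th (V : Com) : theory (Th V).
Proof.
split=> [u v uv S VS phi|u v uv S VS phi|v u w uv vw S VS phi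
         |u v w uv S VS phi|f u v nf uv S VS phi|v].
- by apply: oeval_perm => //; exact: com_commutative VS.
- by rewrite (uv S VS).
- by rewrite (uv S VS) (vw S VS).
- by rewrite !oeval_cat (uv S VS).
- have fpsi i : exists y, oeval phi (f i) = Some y.
    case: (f i) (nf i) => // x s _; exists (eval phi (x, s)).
    exact: oeval_cons.
  have [psi psiP] := choice fpsi.
  by rewrite !(oeval_subst _ psiP) (uv S VS).
- move=> /(_ _ (Com_unit V) (fun=> tt)); case: v => // x v.
  by rewrite oeval_cons.
Qed.

Lemma Th_identities (V : Com) x s y t :
  Th V (x :: s) (y :: t) <-> identities V ((x, s), (y, t)).
Proof.
split=> [uv S VS phi|uv S VS phi].
  by apply: Some_inj; rewrite -!oeval_cons; exact: uv.
by rewrite !oeval_cons; congr Some; exact: uv.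
Qed.

Lemma com_le_Th (V W : Com) : (V <= W)%O <-> subtheory (Th W) (Th V).
Proof.
rewrite com_leE; split=> [/asboolP VW u v uv S /VW|VW]; first exact: uv.
apply/asboolP; have [Sigma WE] := com_variety W; rewrite WE => S VS.
move=> [[x s] [y t]] Sp; have /Th_identities : Th V (x :: s) (y :: t).
  by apply/VW/Th_identities => T; rewrite WE => /(_ _ Sp).
by apply.
Qed.

(** * The relatively free semigroup of a congruence *)

Section QuotientSemigroup.

Variables (R : seq nat -> seq nat -> Prop) (tR : theory R).

(** A chosen representative of the class of [u]; the default is never taken, as the class contains
    [u]. *)
Definition canon (u : seq nat) : seq nat := xget [::] (R u).

Lemma canonP u : R u (canon u).
Proof. by apply: xgetPex; exists u; exact: theory_perm. Qed.

Lemma canon_eq u v : canon u = canon v <-> R u v.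
Proof.
split=> [uv|uv].
  apply: (theory_trans tR (canonP u)); rewrite uv.
  exact: (theory_sym tR (canonP _)).
congr xget; apply: funext => w; apply: propext; split=> [uw|vw].
  exact: (theory_trans tR (theory_sym tR uv)).
exact: (theory_trans tR uv).
Qed.

Definition quotient : Type := {u : seq nat | u <> [::] /\ canon u = u}.

Lemma canon_prop u : u <> [::] -> canon u <> [::] /\ canon (canon u) = canon u.
Proof.
move=> u0; split; last by apply/canon_eq; exact: (theory_sym tR (canonP _)).
by move: (canonP u) => /[swap] -> /(theory_sym tR) /(theory_nil tR).
Qed.

Definition to_quotient u (u0 : u <> [::]) : quotient :=
  exist _ (canon u) (canon_prop u0).

Lemma quotient_inj (a b : quotient) : sval a = sval b -> a = b.
Proof.
case: a b => [u uP] [v vP] /= uv; subst v.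
by congr exist; exact: Prop_irrelevance.
Qed.

Lemma quotient_cat_neq0 (a b : quotient) : sval a ++ sval b <> [::].
Proof. by case: a => [[|x u] []]. Qed.

Definition quotient_mul (a b : quotient) : quotient :=
  to_quotient (@quotient_cat_neq0 a b).

Lemma quotient_mulA : associative quotient_mul.
Proof.
move=> a b c; apply/quotient_inj/canon_eq => /=.
apply: (theory_trans tR (theory_catl _ tR (theory_sym tR (canonP _)))).
by rewrite catA; apply: theory_cat => //; exact: canonP.
Qed.

Definition quotient_semigroup : semigroup :=
  MkSemigroup quotient_mulA (inhabits (@to_quotient [:: 0] ltac:(by []))).

Lemma oeval_quotient (phi : nat -> quotient_semigroup) u : u <> [::] ->
  omap sval (oeval phi u) = Some (canon (subst (fun i => sval (phi i)) u)).
Proof.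
case: u => // x u _; elim: u x => [|y u IHu] x.
  rewrite /subst /= cats0; case: (phi x) => v [v0 vE] /=.
  by congr Some; exact/esym.
change (oeval phi [:: x, y & u])
  with (omul (Some (phi x)) (oeval phi (y :: u))).
case: (oeval phi (y :: u)) (IHu y) => //= b [bE].
congr Some; apply/canon_eq; rewrite bE; apply: theory_catl => //.
exact: (theory_sym tR (canonP _)).
Qed.

Definition quotient_identities : set identity :=
  [set p | R (p.1.1 :: p.1.2) (p.2.1 :: p.2.2)].

Lemma models_quotient : models quotient_identities quotient_semigroup.
Proof.
move=> [[x s] [y t]] Rst phi; apply: Some_inj; rewrite -!oeval_cons.
apply: (inj_omap quotient_inj); rewrite !oeval_quotient//; congr Some.
apply/canon_eq; apply: theory_subst Rst => // i; by case: (phi i) => v [].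
Qed.

Lemma commutative_models : commutative_class (models quotient_identities).
Proof.
move=> S /(_ commutativity) SC; apply/satisfies_commutativity/SC.
exact: theory_perm.
Qed.

Definition Com_theory : Com :=
  MkCom (ex_intro _ quotient_identities erefl) commutative_models.

(** The quotient semigroup lies in the variety, and at the classes of the letters each word takes
    its own class as value, so unrelated words are separated. *)
Lemma Th_Com_theory u v : Th Com_theory u v <-> R u v.
Proof.
split=> [uv|Ruv].
  have tV := theory_Th Com_theory.
  case: u uv => [/(theory_nil tV) ->|x u uv]; first exact: theory_perm.
  have v0 : v <> [::].
    by move=> v0; move: uv; rewrite v0 => /(theory_sym tV) /(theory_nil tV).
  pose phi i : quotient_semigroup := @to_quotient [:: i] ltac:(by []).
  have phiE w : R (subst (fun i => sval (phi i)) w) w.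
    elim: w => [|i w IHw]; first exact: theory_perm.
    apply: (theory_trans tR (theory_catl _ tR IHw)).
    apply: (@theory_cat _ tR _ [:: i]); exact: (theory_sym tR (canonP _)).
  have /(congr1 (omap sval)) := uv _ models_quotient phi.
  rewrite !oeval_quotient// => -[/canon_eq H].
  apply: (theory_trans tR (theory_sym tR (phiE _))).
  exact: (theory_trans tR H).
case: u v Ruv => [|x u] [|y v] Ruv.
- by apply: theory_perm; first exact: theory_Th.
- by have := theory_nil tR Ruv.
- by have := theory_nil tR (theory_sym tR Ruv).
- by apply/Th_identities => S; exact.
Qed.

End QuotientSemigroup.

(** * Lattice operations on varieties and on congruences *)

Lemma Th_join (V W : Com) u v :
  Th (V `|` W)%O u v <-> tmeet (Th V) (Th W) u v.
Proof.
split=> [uv|[uvV uvW]].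
  by split; apply: (proj1 (com_le_Th _ _)) uv; [exact: leUl|exact: leUr].
have tVW := theory_tmeet (theory_Th V) (theory_Th W).
have VW : (V `|` W <= Com_theory tVW)%O.
  by rewrite leUx; apply/andP; split; apply/com_le_Th => a b /Th_Com_theory[].
by apply: (proj1 (com_le_Th _ _) VW); exact/Th_Com_theory.
Qed.

Lemma Th_meet (V W : Com) u v :
  Th (V `&` W)%O u v <-> tjoin (Th V) (Th W) u v.
Proof.
split=> [uv|].
  have tVW := theory_tjoin (theory_Th V) (theory_Th W).
  apply/(Th_Com_theory tVW); apply: (proj1 (com_le_Th _ _)) uv.
  rewrite lexI; apply/andP.
  split; apply/com_le_Th => a b ab; apply/Th_Com_theory.
    exact: tjoinl.
  exact: tjoinr.
apply; first by apply: theory_equivalence; exact: theory_Th.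
  by apply/com_le_Th; exact: leIl.
by apply/com_le_Th; exact: leIr.
Qed.

Lemma lower_modular_upper (V : Com) :
  lower_modular_element V -> upper_modular (Th V).
Proof.
move=> mV B C tB tC BV u v [Vuv BCuv].
have ThB := Th_Com_theory tB; have ThC := Th_Com_theory tC.
have VB : (V <= Com_theory tB)%O by apply/com_le_Th => a b /ThB /BV.
have : Th (Com_theory tB `&` (V `|` Com_theory tC))%O u v.
  rewrite -mV//; apply/Th_join; split=> //; apply/Th_meet.
  by move=> E eE BE CE; apply: BCuv => // a b ab; [apply/BE/ThB|apply/CE/ThC].
move=> /Th_meet uv E eE BE CE; apply: uv => // a b.
  by move=> /ThB /BE.
by move=> /Th_join[Vab /ThC Cab]; exact: CE.
Qed.

(** As the order is reversed, the congruences of [Z] and [Y] play the roles of [B] and [C]. Only one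
    inclusion uses the hypothesis; the other holds in every lattice. *)
Lemma modular_theory_modular (V : Com) :
  modular_theory (Th V) -> modular_element V.
Proof.
move=> mV Y Z /com_le_Th ZY.
have tY := theory_Th Y; have tZ := theory_Th Z.
apply/eqP; rewrite eq_le; apply/andP; split; apply/com_le_Th => u v.
  move=> /Th_join[/Th_meet VZ Yuv]; apply/Th_meet.
  have := mV _ _ tZ tY ZY u v (conj VZ Yuv).
  move=> H E eE VYE ZE; apply: H => // a b Hab; apply: VYE; exact/Th_join.
move=> /Th_meet uv; apply/Th_join; split.
  apply/Th_meet; apply: uv.
    exact: theory_equivalence (theory_tjoin (theory_Th V) tZ).
    by move=> a b /Th_join[Vab _]; exact: tjoinl.
  exact: tjoinr.
apply: uv => //; first exact: theory_equivalence.
by move=> a b /Th_join[].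
Qed.

Theorem corollary4p1 (V : Com) :
  lower_modular_element V -> modular_element V.
Proof.
move=> /lower_modular_upper mV; apply: modular_theory_modular.
have tV := theory_Th V.
have [rV|rV] := upper_modular_rees tV mV; first exact: rees_theory_modular.
exact: content_rees_theory_modular.
Qed.
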